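(* There exist two increasing unbounded sequences $\{\tau_n\}_{n\geq 1}$ and $\{\varsigma_n\}_{n\geq 1}$ of positive numbers such that the sequences of functions $\{\zeta(s+i\tau_n)\}_{n\geq 1}$ and $\{\zeta(s+i\varsigma_n)\}_{n\geq 1}$ converge uniformly to $\zeta(s)$ and $\zeta_{\lambda}(s)$, respectively, on every reduced strip of $\{s\in\mathbb{C}:\operatorname{Re}s>1\}$.
   Context: $\zeta$ is the Riemann zeta function. $\zeta_{\lambda}(s):=\sum_{n\geq 1}\frac{\lambda(n)}{n^s}$ for $\operatorname{Re}s>1$, where $\lambda(n)=(-1)^{\Omega(n)}$ is the Liouville function ($\Omega(n)$ being the number of prime factors of $n$ counted with multiplicity). A reduced strip of $\{\operatorname{Re}s>1\}$ is a set $\{s:\sigma_1\le\operatorname{Re}s\le\sigma_2\}$ with $1<\sigma_1<\sigma_2<\infty$. *)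

(* Defs.v *)
(* Stdlib reals with Coquelicot's complex numbers [C]; MathComp is used only
   for prime factorisations of natural numbers. *)
From mathcomp Require Import all_boot.
From Stdlib Require Import Reals.
From Coquelicot Require Import Coquelicot.

Set Implicit Arguments.
Unset Strict Implicit.
Unset Printing Implicit Defensive.

Open Scope R_scope.

(* [prime_decomp n] lists the pairs (p, e) such that p ^ e exactly divides n. *)
Definition bigOmega (n : nat) : nat :=
  (\sum_(pe <- prime_decomp n) pe.2)%N.

Definition liouville (n : nat) : R := (-1) ^ bigOmega n.

Definition Cexp (z : C) : C :=
  (exp (Re z) * cos (Im z), exp (Re z) * sin (Im z)).

(* n ^ s with the principal (real) logarithm of n; meaningful for 0 < n. *)
Definition nat_Cpow (n : nat) (s : C) : C :=
  Cexp (s * RtoC (ln (INR n)))%C.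

(* Coquelicot's [Series] is real-valued only; a complex series is summed
   componentwise, as justified by [CSeries_correct]. *)
Definition CSeries (a : nat -> C) : C :=
  (Series (fun n => Re (a n)), Series (fun n => Im (a n))).

Lemma is_series_C_split (a : nat -> C) (l : C) :
  is_series (V := C_R_NormedModule) a l ->
  is_series (fun n => Re (a n)) (Re l) /\ is_series (fun n => Im (a n)) (Im l).
Proof.
move=> Ha.
have Hre n : Re (sum_n (G := C_R_NormedModule) a n)
               = sum_n (fun k => Re (a k)) n.
  elim: n => [|n IH]; first by rewrite !sum_O.
  by rewrite !sum_Sn -IH.
have Him n : Im (sum_n (G := C_R_NormedModule) a n)
               = sum_n (fun k => Im (a k)) n.
  elim: n => [|n IH]; first by rewrite !sum_O.
  by rewrite !sum_Sn -IH.
split.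
- rewrite /is_series; apply: filterlim_ext; first exact: Hre.
  apply: (filterlim_comp _ _ _ _ _ _ _ _ Ha) => P [e He].
  by exists e => z [Hz _]; apply: He.
- rewrite /is_series; apply: filterlim_ext; first exact: Him.
  apply: (filterlim_comp _ _ _ _ _ _ _ _ Ha) => P [e He].
  by exists e => z [_ Hz]; apply: He.
Qed.

Lemma CSeries_correct (a : nat -> C) (l : C) :
  is_series (V := C_R_NormedModule) a l -> CSeries a = l.
Proof.
case/is_series_C_split => /is_series_unique Hre /is_series_unique Him.
by rewrite /CSeries Hre Him -surjective_pairing.
Qed.

(* The series is over n >= 1, hence the index shift; for bounded coefficients
   [c] it is only meant for Re s > 1. *)
Definition dirichlet_series (c : nat -> R) (s : C) : C :=
  CSeries (fun k => (RtoC (c k.+1) / nat_Cpow k.+1 s)%C).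

(* The Riemann zeta function on the half-plane Re s > 1, where it is given by
   its Dirichlet series; elsewhere the value is meaningless. *)
Definition zeta (s : C) : C := dirichlet_series (fun _ => 1) s.

Definition zeta_lambda (s : C) : C := dirichlet_series liouville s.

Definition reduced_strip (S : C -> Prop) : Prop :=
  exists sigma1 sigma2 : R,
    1 < sigma1 /\ sigma1 < sigma2 /\
    (forall s : C, S s <-> sigma1 <= Re s <= sigma2).

Definition cvg_uniformly_on (S : C -> Prop) (f : nat -> C -> C) (g : C -> C) :
    Prop :=
  forall eps : R, 0 < eps ->
    exists N : nat, forall n : nat, (N <= n)%nat ->
      forall s : C, S s -> Cmod (f n s - g s)%C < eps.

Definition strictly_increasing (u : nat -> R) : Prop :=
  forall n : nat, u n < u n.+1.

Definition unbounded_above (u : nat -> R) : Prop :=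
  forall M : R, exists n : nat, M < u n.

(* Main.v *)
Require Import Defs.
From Stdlib Require Import Reals Lra ClassicalEpsilon.
From Coquelicot Require Import Coquelicot.
From HB Require Import structures.
From mathcomp Require Import all_boot.

(** A vertical shift by t multiplies the n-th term of the Dirichlet series by
    n^(-it), so both claims amount to finding arbitrarily large t for which
    n^(-it) is close to c(n) for every n <= N, where c is 1 or the Liouville
    function.  Once this holds for larger and larger N, absolute convergence
    does the rest: on Re s >= sigma the first N terms of the two series nearly
    agree, and the remainders are dominated by the tail of sum n^(-sigma),
    uniformly in s (cvg_shift_zeta).  The estimate does not depend on the
    strip except through sigma, so one sequence of shifts serves all strips.

    The recurrence statement is a case of Kronecker's theorem for the logarithms
    of the primes.  Here it is proved by a mean value argument, which draws on
    the fact that c is completely multiplicative with values 1 and -1.  For a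
    finite set M of positive integers, let
    W(t) = |sum_(m in M) c(m) m^(it)|^2.  Trigonometric sums have a mean value;
    that of cos (t (ln m - ln n)) is 1 or 0 according as m = n or not.
    Expanding the square, the mean of W(t) is the size of M and the mean of
    c(q) W(t) cos (t ln q) is the number of m in M with qm in M, because
    c(q) c(m) c(qm) = 1.  Hence W(t) (1 - c(q) cos (t ln q)) has as its mean the
    number of m in M with qm outside M (has_mean_kernel_defect).

    If M is almost invariant under multiplication by each q <= N, that is, a
    Folner set, these means are small compared with the mean of W.  As W >= 0,
    the nonnegative quantities 1 - c(q) cos (t ln q), for q <= N, must then be
    simultaneously small at arbitrarily large t (recurrence_of_folner), and
    |q^(-it) - c(q)|^2 = 2 (1 - c(q) cos (t ln q)).

    Folner sets exist by growth (exists_folner): there are at most (K+1)^N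
    products of 1, ..., N with exponents at most K, which is polynomial in K, so
    for some K the passage from K to K+1 enlarges this set by a factor close
    to 1; multiplication by q <= N raises a single exponent by one. *)

Set Implicit Arguments.
Unset Strict Implicit.
Unset Printing Implicit Defensive.

Local Open Scope R_scope.

(** * Finite sums of reals *)

Fact RplusA : associative Rplus. Proof. by move=> x y z; ring. Qed.
Fact RplusC : commutative Rplus. Proof. by move=> x y; ring. Qed.
Fact Rplus0 : left_id 0 Rplus. Proof. by move=> x; ring. Qed.
HB.instance Definition _ :=
  Monoid.isComLaw.Build R 0 Rplus RplusA RplusC Rplus0.
Fact Rmul0 : left_zero 0 Rmult. Proof. by move=> x; ring. Qed.
Fact Rmulz : right_zero 0 Rmult. Proof. by move=> x; ring. Qed.
HB.instance Definition _ := Monoid.isMulLaw.Build R 0 Rmult Rmul0 Rmulz.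
Fact RmulDl : left_distributive Rmult Rplus. Proof. by move=> x y z; ring. Qed.
Fact RmulDr : right_distributive Rmult Rplus. Proof. by move=> x y z; ring. Qed.
HB.instance Definition _ := Monoid.isAddLaw.Build R Rmult Rplus RmulDl RmulDr.

Notation "\rsum_ ( i <- r ) F" := (\big[Rplus/0]_(i <- r) F)
  (at level 41, F at level 41, i, r at level 50).

Lemma rsum_ge0 (I : eqType) (r : seq I) (F : I -> R) :
  (forall i, i \in r -> 0 <= F i) -> 0 <= \rsum_(i <- r) F i.
Proof.
move=> F0; rewrite big_seq; apply: (big_ind (fun x => 0 <= x)) => //.
- exact: Rle_refl.
- by move=> x y; lra.
Qed.

Lemma rsum_le_const (I : eqType) (r : seq I) (F : I -> R) b :
  (forall i, i \in r -> F i <= b) -> \rsum_(i <- r) F i <= INR (size r) * b.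
Proof.
elim: r => [_|i r IH Fb]; first by rewrite big_nil Rmult_0_l; apply: Rle_refl.
rewrite big_cons [size _]/= S_INR.
have := Fb i (mem_head i r).
have := IH (fun j jr => Fb j (mem_behead (s := i :: r) jr)).
by lra.
Qed.

Lemma rsum_ge_term (I : eqType) (r : seq I) (F : I -> R) j :
  (forall i, i \in r -> 0 <= F i) -> j \in r -> F j <= \rsum_(i <- r) F i.
Proof.
move=> F0 jr; rewrite (big_rem j) //=.
have: 0 <= \rsum_(i <- rem j r) F i.
  by apply: rsum_ge0 => i /mem_rem; apply: F0.
lra.
Qed.

Lemma rsum_indicator (I : Type) (r : seq I) (a : pred I) :
  \rsum_(i <- r) (if a i then 1 else 0) = INR (count a r).
Proof.
elim: r => [|i r IH]; first by rewrite big_nil.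
by rewrite big_cons IH /= plus_INR; case: (a i).
Qed.

(** * Mean values of functions of a real variable *)

(** The mean value is the limit of (1/T) int_0^T f.  A bounded difference
    between an antiderivative and a linear function is stronger, holds for all
    the trigonometric sums below, and avoids both integrals and limits. *)
Definition has_mean (f : R -> R) (a : R) : Prop :=
  exists F B, (forall t, is_derive F t (f t)) /\
              (forall t, Rabs (F t - a * t) <= B).

Lemma has_mean_ext f g a : f =1 g -> has_mean f a -> has_mean g a.
Proof.
by move=> fg [F [B [dF bF]]]; exists F, B; split=> // t; rewrite -fg.
Qed.

(** The orthogonality relation behind every mean value computed below: as ln is
    injective, different natural numbers give different frequencies. *)
Lemma has_mean_cos_ln (m n : nat) : (0 < m)%N -> (0 < n)%N ->
  has_mean (fun t => cos (t * (ln (INR m) - ln (INR n))))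
           (if (m == n)%N then 1 else 0).
Proof.
move=> m0 n0; set w := _ - _.
case: eqVneq => [mn|/eqP mn].
  exists (fun t => t), 0; split=> t.
    by rewrite /w mn Rminus_diag Rmult_0_r cos_0; apply: is_derive_id.
  by rewrite Rmult_1_l Rminus_diag Rabs_R0; exact: Rle_refl.
have w0 : w <> 0.
  move=> w0; apply/mn/INR_eq/ln_inv; last by move: w0; rewrite /w; lra.
  - by apply: lt_0_INR; apply/ltP.
  - by apply: lt_0_INR; apply/ltP.
exists (fun t => sin (t * w) / w), (/ Rabs w); split=> t.
  by auto_derive => //; field.
rewrite Rmult_0_l Rminus_0_r Rabs_mult Rabs_inv.
have : Rabs (sin (t * w)) <= 1 by apply: Rabs_le; apply: SIN_bound.
have : 0 < / Rabs w by apply: Rinv_0_lt_compat; apply: Rabs_pos_lt.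
by nra.
Qed.

Lemma has_mean_plus f g a b :
  has_mean f a -> has_mean g b -> has_mean (fun t => f t + g t) (a + b).
Proof.
move=> [F [B [dF bF]]] [G [C [dG bG]]].
exists (fun t => F t + G t), (B + C); split=> t.
  exact: (is_derive_plus F G).
have -> : F t + G t - (a + b) * t = (F t - a * t) + (G t - b * t) by ring.
apply: Rle_trans (Rabs_triang _ _) _.
by move: (bF t) (bG t); lra.
Qed.

Lemma has_mean_scal k f a : has_mean f a -> has_mean (fun t => k * f t) (k * a).
Proof.
move=> [F [B [dF bF]]]; exists (fun t => k * F t), (Rabs k * B); split=> t.
  exact: is_derive_scal.
have -> : k * F t - k * a * t = k * (F t - a * t) by ring.
by rewrite Rabs_mult; apply: Rmult_le_compat_l => //; apply: Rabs_pos.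
Qed.

Lemma has_mean_rsum (I : eqType) (r : seq I) (f : I -> R -> R) (a : I -> R) :
  (forall i, i \in r -> has_mean (f i) (a i)) ->
  has_mean (fun t => \rsum_(i <- r) f i t) (\rsum_(i <- r) a i).
Proof.
elim: r => [_|i r IH fa].
  rewrite big_nil; exists (fun=> 0), 0; split=> t.
    rewrite big_nil.
    exact: (is_derive_const (K := R_AbsRing) (V := R_NormedModule) 0).
  by rewrite Rmult_0_l Rminus_0_r Rabs_R0; exact: Rle_refl.
rewrite big_cons.
have fi := fa i (mem_head i r).
have {}IH := IH (fun j jr => fa j (mem_behead (s := i :: r) jr)).
by apply: has_mean_ext (has_mean_plus fi IH) => t; rewrite big_cons.
Qed.

(** This turns a negative mean into negative values at arbitrarily large
    arguments: if f >= 0 beyond T, its antiderivative is nondecreasing there and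
    cannot follow a line of negative slope. *)
Lemma has_mean_ge0 f a T :
  has_mean f a -> (forall t, T <= t -> 0 <= f t) -> 0 <= a.
Proof.
move=> [F [B [dF bF]]] f0; apply: Rnot_lt_le => a0.
have B0 : 0 <= B by apply: Rle_trans (Rabs_pos _) (bF 0).
(* The line a t drops by 2 B + 1 between T and t, which is more than the
   error terms at the two endpoints can compensate. *)
pose t := T + (2 * B + 1) / (- a).
have Tt : T < t.
  suff : 0 < (2 * B + 1) / (- a) by rewrite /t; lra.
  by apply: Rdiv_lt_0_compat; lra.
have [|s _|s [[Hs _] eF]] := @MVT_gen F T t f.
- by move=> s _; apply: dF.
- apply/continuity_pt_filterlim.
  apply: (ex_derive_continuous (K := R_AbsRing) (V := R_NormedModule)).
  by exists (f s); apply: dF.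
rewrite Rmin_left in Hs; last lra.
have at_ : a * t = a * T - (2 * B + 1) by rewrite /t; field; lra.
have := proj1 (Rabs_le_between _ _) (bF T).
have := proj1 (Rabs_le_between _ _) (bF t).
have := f0 _ Hs.
by rewrite at_; nra.
Qed.

(** * The mean value argument for completely multiplicative signs *)

Definition multiplicative_sign (c : nat -> R) : Prop :=
  (forall n, c n * c n = 1) /\
  (forall m n, (0 < m)%N -> (0 < n)%N -> c (m * n)%N = c m * c n).

(** The squared modulus of the Dirichlet polynomial sum_(m in M) c(m) m^(it),
    written through its real and imaginary parts. *)
Definition kernel (c : nat -> R) (M : seq nat) (t : R) : R :=
  Rsqr (\rsum_(m <- M) (c m * cos (t * ln (INR m)))) +
  Rsqr (\rsum_(m <- M) (c m * sin (t * ln (INR m)))).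

Lemma kernel_ge0 c M t : 0 <= kernel c M t.
Proof. by apply: Rplus_le_le_0_compat; apply: Rle_0_sqr. Qed.

Lemma kernel_mul_cos c M t w :
  kernel c M t * cos (t * w) =
  \rsum_(m <- M) \rsum_(n <- M)
    (c m * c n * cos (t * (ln (INR m) + w - ln (INR n)))).
Proof.
pose a m := t * ln (INR m); set th := t * w.
pose A := \rsum_(m <- M) (c m * cos (a m)).
pose B := \rsum_(m <- M) (c m * sin (a m)).
have lin (x y : R) (f g : nat -> R) :
    \rsum_(m <- M) (x * f m + y * g m) =
    x * (\rsum_(m <- M) f m) + y * (\rsum_(m <- M) g m).
  by rewrite big_split /= -!big_distrr.
transitivity (\rsum_(m <- M) ((A * cos th + B * sin th) * (c m * cos (a m)) +
                              (B * cos th - A * sin th) * (c m * sin (a m)))).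
  by rewrite lin /kernel /Rsqr -/A -/B; ring.
apply: eq_bigr => m _.
transitivity (\rsum_(n <- M) ((c m * cos (a m + th)) * (c n * cos (a n)) +
                              (c m * sin (a m + th)) * (c n * sin (a n)))).
  by rewrite lin -/A -/B cos_plus sin_plus; ring.
apply: eq_bigr => n _.
have -> : t * (ln (INR m) + w - ln (INR n)) = (a m + th) - a n.
  by rewrite /a /th; ring.
by rewrite cos_minus; ring.
Qed.

Lemma multiplicative_sign1 c : multiplicative_sign c -> c 1%N = 1.
Proof. by case=> sq mul; rewrite -[RHS](sq 1%N) -mul. Qed.

(** Only the pairs (m, n) with n = q m contribute to the mean, and each of them
    contributes c(q) c(m) c(q m) = (c(q) c(m))^2 = 1. *)
Lemma has_mean_kernel_shift c (M : seq nat) q :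
  multiplicative_sign c -> uniq M -> {in M, forall m, (0 < m)%N} -> (0 < q)%N ->
  has_mean (fun t => c q * (kernel c M t * cos (t * ln (INR q))))
           (INR (count (fun m => (q * m)%N \in M) M)).
Proof.
move=> [sq mul] uM M0 q0.
rewrite -rsum_indicator.
have -> : \rsum_(m <- M) (if (q * m)%N \in M then 1 else 0) =
  \rsum_(m <- M) \rsum_(n <- M)
    ((c q * (c m * c n)) * (if (q * m == n)%N then 1 else 0)).
  rewrite big_seq [RHS]big_seq; apply: eq_bigr => m mM.
  transitivity (\rsum_(n <- M) (if n == (q * m)%N then 1 else 0)).
    rewrite rsum_indicator count_uniq_mem //.
    by case: (_ \in _).
  apply: eq_bigr => n _; rewrite eq_sym; case: eqP => [<-|_]; last by ring.
  rewrite mul // ?M0 //.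
  have -> : c q * (c m * (c q * c m)) = (c q * c q) * (c m * c m) by ring.
  by rewrite !sq; ring.
apply: (has_mean_ext (f := fun t => \rsum_(m <- M) \rsum_(n <- M)
    ((c q * (c m * c n)) *
     cos (t * (ln (INR (q * m)%N) - ln (INR n)))))); last first.
  apply: has_mean_rsum => m mM; apply: has_mean_rsum => n nM.
  apply: has_mean_scal; apply: has_mean_cos_ln; last exact: M0.
  by rewrite muln_gt0 q0 M0.
move=> t; rewrite kernel_mul_cos big_distrr /= big_seq [RHS]big_seq.
apply: eq_bigr => m mM; rewrite big_distrr; apply: eq_bigr => n _ /=.
rewrite mult_INR ln_mult; last 2 first.
- by apply: lt_0_INR; apply/ltP.
- by apply: lt_0_INR; apply/ltP/M0.
by rewrite (Rplus_comm (ln (INR q))); ring.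
Qed.

Lemma has_mean_kernel c (M : seq nat) :
  multiplicative_sign c -> uniq M -> {in M, forall m, (0 < m)%N} ->
  has_mean (kernel c M) (INR (size M)).
Proof.
move=> cP uM M0.
have := has_mean_kernel_shift cP uM M0 (ltn0Sn 0).
have -> : count (fun m => (1 * m)%N \in M) M = size M.
  by apply/eqP; rewrite -all_count; apply/allP => m mM; rewrite mul1n.
apply: has_mean_ext => t.
by rewrite (multiplicative_sign1 cP) ln_1 Rmult_0_r cos_0; ring.
Qed.

Lemma has_mean_kernel_defect c (M : seq nat) q :
  multiplicative_sign c -> uniq M -> {in M, forall m, (0 < m)%N} -> (0 < q)%N ->
  has_mean (fun t => kernel c M t * (1 - c q * cos (t * ln (INR q))))
           (INR (count (fun m => (q * m)%N \notin M) M)).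
Proof.
move=> cP uM M0 q0.
have := has_mean_plus (has_mean_kernel cP uM M0)
  (has_mean_scal (-1) (has_mean_kernel_shift cP uM M0 q0)).
rewrite -[size M](count_predC (fun m => (q * m)%N \in M)) plus_INR.
have cancel x y : x + y + -1 * x = y by ring.
rewrite cancel.
by apply: has_mean_ext => t; ring.
Qed.

(** Otherwise the sum of the 1 - c(q) cos (t ln q) over q <= N would be at least
    d for all t > T, although its average against the nonnegative weight given
    by the kernel is at most N e < d. *)
Lemma recurrence_of_folner c (M : seq nat) (N : nat) (d e T : R) :
  multiplicative_sign c -> INR N * e < d ->
  uniq M -> {in M, forall m, (0 < m)%N} -> (0 < size M)%N ->
  (forall q, (0 < q <= N)%N ->
     INR (count (fun m => (q * m)%N \notin M) M) <= e * INR (size M)) ->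
  exists2 t, T < t &
    forall q, (0 < q <= N)%N -> 1 - c q * cos (t * ln (INR q)) < d.
Proof.
move=> cP ed uM M0 sM folner; apply: NNPP => no_t.
pose g q t := 1 - c q * cos (t * ln (INR q)).
pose defect q := INR (count (fun m => (q * m)%N \notin M) M).
have g0 q t : 0 <= g q t.
  have := COS_bound (t * ln (INR q)).
  have : c q * c q = 1 by case: cP => sq _.
  by rewrite /g; nra.
have mean : has_mean
    (fun t => \rsum_(q <- iota 1 N) (kernel c M t * g q t) + - d * kernel c M t)
    (\rsum_(q <- iota 1 N) defect q + - d * INR (size M)).
  apply: has_mean_plus; last exact/has_mean_scal/has_mean_kernel.
  apply: has_mean_rsum => q; rewrite mem_iota => /andP[q0 _].
  exact: has_mean_kernel_defect.
suff : 0 <= \rsum_(q <- iota 1 N) defect q + - d * INR (size M).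
  apply: Rlt_not_le.
  have : \rsum_(q <- iota 1 N) defect q <= INR N * (e * INR (size M)).
    rewrite -[N in INR N](size_iota 1); apply: rsum_le_const => q.
    by rewrite mem_iota add1n ltnS; apply: folner.
  have : 0 < INR (size M) by apply: lt_0_INR; apply/ltP.
  by nra.
apply: has_mean_ge0 (T + 1) mean _ => t Tt.
rewrite -big_distrr /=.
suff : d <= \rsum_(q <- iota 1 N) g q t by move: (kernel_ge0 c M t); nra.
have [q qN gq] : exists2 q, (0 < q <= N)%N & d <= g q t.
  apply: NNPP => no_q; apply: no_t; exists t; first lra.
  move=> q qN; apply: Rnot_le_lt => le_d; apply: no_q; exists q => //.
apply: Rle_trans gq _.
apply: (rsum_ge_term (F := fun q => g q t)) => //.
by rewrite mem_iota add1n ltnS.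
Qed.

(** * The Liouville function is completely multiplicative *)

(** Summing over a range of indices that depends only on a bound for n lets the
    factorisations of m, n and m n be compared term by term. *)
Lemma bigOmega_range n B : (n < B)%N ->
  bigOmega n = (\sum_(p <- iota 0 B) logn p n)%N.
Proof.
move=> nB; rewrite /bigOmega prime_decompE big_map /=.
have -> : (\sum_(p <- iota 0 B) logn p n =
           \sum_(p <- iota 0 B | p \in primes n) logn p n)%N.
  rewrite [RHS]big_mkcond; apply: eq_bigr => p _.
  by rewrite -logn_gt0; case: (logn p n).
rewrite -[RHS]big_filter; apply: (perm_big (op := addn)); apply: uniq_perm.
- exact: primes_uniq.
- by rewrite filter_uniq ?iota_uniq.
move=> p; rewrite mem_filter mem_iota add0n leq0n /=.
case pn: (p \in primes n) => //=; apply/esym.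
move: pn; rewrite mem_primes => /and3P[_ n0 pn].
exact: leq_ltn_trans (dvdn_leq n0 pn) nB.
Qed.

Lemma bigOmegaM m n : (0 < m)%N -> (0 < n)%N ->
  bigOmega (m * n)%N = (bigOmega m + bigOmega n)%N.
Proof.
move=> m0 n0; pose B := (m * n).+1.
have mB : (m < B)%N by rewrite ltnS leq_pmulr.
have nB : (n < B)%N by rewrite ltnS leq_pmull.
rewrite (bigOmega_range mB) (bigOmega_range nB) (bigOmega_range (ltnSn _)).
by rewrite -big_split; apply: eq_bigr => p _; rewrite lognM.
Qed.

(** * Folner sets of positive integers *)

(** All the integers from 1 to N serve as generators, so that multiplication by
    any q <= N raises a single exponent by one.  Different exponents may give
    the same product, which undup counts once. *)
Definition box (N K : nat) : seq nat :=
  undup [seq (\prod_(i < N) i.+1 ^ e i)%N | e : {ffun 'I_N -> 'I_K.+1}].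

Lemma boxP N K m :
  reflect (exists2 e : 'I_N -> nat, (forall i, (e i <= K)%N) &
             m = (\prod_(i < N) i.+1 ^ e i)%N)
          (m \in box N K).
Proof.
rewrite mem_undup; apply: (iffP idP).
  case/imageP => e _ ->; exists (fun i => nat_of_ord (e i)) => // i.
  by rewrite -ltnS ltn_ord.
case=> e eK ->; apply/imageP; exists [ffun i => inord (e i)] => //.
by apply: eq_bigr => i _; rewrite ffunE inordK // ltnS.
Qed.

Lemma box_gt0 N K : {in box N K, forall m, (0 < m)%N}.
Proof. by move=> m /boxP[e _ ->]; apply: prodn_gt0 => i; rewrite expn_gt0. Qed.

Lemma size_box_gt0 N K : (0 < size (box N K))%N.
Proof.
have : 1%N \in box N K.
  by apply/boxP; exists (fun=> 0%N) => //; rewrite big1.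
by case: (box N K).
Qed.

Lemma size_box_le N K : (size (box N K) <= K.+1 ^ N)%N.
Proof.
apply: leq_trans (size_undup _) _.
by rewrite size_image card_ffun !card_ord.
Qed.

Lemma box_sub N K : {subset box N K <= box N K.+1}.
Proof.
by move=> m /boxP[e eK ->]; apply/boxP; exists e => // i; apply: leqW.
Qed.

Lemma box_mul N K q m : (0 < q <= N)%N -> m \in box N K ->
  (q * m)%N \in box N K.+1.
Proof.
case/andP; case: q => // q _ qN /boxP[e eK ->]; apply/boxP.
pose j := Ordinal qN.
exists (fun i => (e i + (i == j))%N) => [i|].
  by rewrite -addn1; apply: leq_add => //; case: (i == j).
under [RHS]eq_bigr => i _ do rewrite expnD.
rewrite big_split /= mulnC; congr muln.
by rewrite (bigD1 j) //= eqxx big1 ?muln1 // => i /negbTE ->.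
Qed.

(** The products q m that leave the box are distinct elements of the next box,
    which also contains the box itself. *)
Lemma count_box_defect N K q : (0 < q <= N)%N ->
  (count (fun m => (q * m)%N \notin box N K) (box N K) + size (box N K)
     <= size (box N K.+1))%N.
Proof.
move=> qN; rewrite -size_filter; set s := filter _ _.
rewrite -(size_map (muln q)) -size_cat; apply: uniq_leq_size.
  rewrite cat_uniq undup_uniq andbT map_inj_uniq ?filter_uniq ?undup_uniq //.
    apply/hasPn => m mB; apply/mapP => -[n].
    rewrite mem_filter => /andP[nB _] mE.
    by move: nB; rewrite -mE mB.
  by case/andP: qN => q0 _ m n /eqP; rewrite eqn_pmul2l // => /eqP.
move=> m; rewrite mem_cat => /orP[/mapP[n]|]; last exact: box_sub.
by rewrite mem_filter => /andP[_ nB] ->; apply: box_mul.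
Qed.

Lemma INR_expn m n : INR (m ^ n)%N = INR m ^ n.
Proof. by elim: n => [|n IH]; rewrite ?expn0 // expnS mult_INR IH. Qed.

(** If every step multiplied a by more than 1 + d, then a would grow
    exponentially. *)
Lemma polynomial_growth_slow_step (a : nat -> nat) (N : nat) (d : R) :
  0 < d -> (forall K, (0 < a K <= K.+1 ^ N)%N) ->
  exists K, INR (a K.+1) <= (1 + d) * INR (a K).
Proof.
move=> d0 aN; apply: NNPP => no_K.
have growth K : (1 + d) ^ K <= INR (a K).
  elim: K => [|K IH] /=.
    by case/andP: (aN 0%N) => /leP a0 _; apply: (le_INR 1).
  apply: Rle_trans (Rmult_le_compat_l _ _ _ _ IH) _; first lra.
  by apply: Rlt_le; apply: Rnot_le_lt => le_K; apply: no_K; exists K.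
(* At K = m (N + 1), Bernoulli's inequality gives the lower bound
   (e (m + 1))^(N + 1), of degree N + 1 in m, against the upper bound
   ((N + 1) (m + 1))^N of degree N. *)
pose e := Rmin 1 d.
have [e0 e1 ed] : [/\ 0 < e, e <= 1 & e <= d].
  by split; [apply: Rmin_pos; lra | apply: Rmin_l | apply: Rmin_r].
have eN0 : 0 < e ^ N.+1 by apply: pow_lt.
have [m mP] := INR_unbounded (INR N.+1 ^ N / e ^ N.+1).
have m0 := pos_INR m.
have : (e * INR m.+1) ^ N.+1 <= (INR N.+1 * INR m.+1) ^ N.
  apply: (Rle_trans _ (((1 + d) ^ m) ^ N.+1)).
    apply: pow_incr; split; first by rewrite S_INR; nra.
    by have := poly m d d0; rewrite S_INR; nra.
  rewrite -pow_mult; apply: Rle_trans (growth _) _.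
  rewrite -mult_INR -INR_expn; apply: le_INR; apply/leP.
  case/andP: (aN (m * N.+1)%N) => _ /leq_trans; apply.
  have le_base : ((m * N.+1).+1 <= N.+1 * m.+1)%N.
    by rewrite mulnC mulnS addSn ltnS leq_addl.
  by case: (N) le_base => [|N'] le_base; rewrite ?expn0 // leq_exp2r.
rewrite !Rpow_mult_distr.
have s0 : 0 < INR m.+1 by apply: lt_0_INR; apply/ltP.
have sN0 : 0 < INR m.+1 ^ N by apply: pow_lt.
have : INR N.+1 ^ N < e ^ N.+1 * INR m.+1.
  have := Rmult_lt_compat_l _ _ _ eN0 mP.
  rewrite /Rdiv Rmult_comm Rmult_assoc Rinv_l ?Rmult_1_r; last lra.
  by rewrite (S_INR m); nra.
move=> /(Rmult_lt_compat_r _ _ _ sN0) + le_pow.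
rewrite -[(INR m.+1) ^ N.+1]/(INR m.+1 * INR m.+1 ^ N) in le_pow.
by lra.
Qed.

Lemma exists_folner (N : nat) (d : R) : 0 < d ->
  exists M : seq nat, [/\ uniq M, {in M, forall m, (0 < m)%N},
    (0 < size M)%N &
    forall q, (0 < q <= N)%N ->
      INR (count (fun m => (q * m)%N \notin M) M) <= d * INR (size M)].
Proof.
move=> d0.
have [K KP] := @polynomial_growth_slow_step (fun K => size (box N K)) N d d0
  (fun K => introT andP (conj (size_box_gt0 N K) (size_box_le N K))).
exists (box N K); split=> [||| q qN]; first exact: undup_uniq.
- exact: box_gt0.
- exact: size_box_gt0.
have /leP/le_INR := count_box_defect K qN.
by rewrite plus_INR; lra.
Qed.

(** * Dominated Dirichlet series *)

Lemma Cmod_le_Re_Im z : Cmod z <= Rabs (Re z) + Rabs (Im z).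
Proof.
rewrite {1}(_ : z = (RtoC (Re z) + Ci * RtoC (Im z))%C); last first.
  by case: z => x y; rewrite /Cplus /Cmult /=; congr (_, _); ring.
apply: Rle_trans (Cmod_triangle _ _) _.
have Ci1 : Cmod Ci = 1 by rewrite /Cmod /= -[RHS]sqrt_1; congr sqrt; ring.
by rewrite Cmod_mult !Cmod_R Ci1 Rmult_1_l; apply: Rle_refl.
Qed.

(** Comparison with a telescoping series: with a = sigma - 1, the bound
    exp u >= 1 + u gives a (n+2)^(-sigma) <= (n+1)^(-a) - (n+2)^(-a). *)
Lemma ex_series_inv_power sigma : 1 < sigma ->
  ex_series (fun n : nat => exp (- (sigma * ln (INR n.+1)))).
Proof.
move=> sigma1; pose a := sigma - 1.
pose v n := exp (- (a * ln (INR n.+1))).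
have [l vl] : ex_finite_lim_seq v.
  apply: (ex_finite_lim_seq_decr v 0) => n; last exact/Rlt_le/exp_pos.
  apply/Rlt_le/exp_increasing.
  have : ln (INR n.+1) < ln (INR n.+2).
    by apply: ln_increasing; [apply: lt_0_INR | apply: lt_INR]; apply/ltP.
  by rewrite /a; nra.
apply/(ex_series_incr_1 (V := R_NormedModule)).
apply: (ex_series_le (K := R_AbsRing) (V := R_CompleteNormedModule) _
  (fun n => / a * (v n - v n.+1))).
  move=> n; rewrite /norm /= /abs /= Rabs_pos_eq; last exact/Rlt_le/exp_pos.
  set x := ln (INR n.+1); set y := ln (INR n.+2).
  have [N1 N2] : 0 < INR n.+1 /\ 0 < INR n.+2.
    by split; apply: lt_0_INR; apply/ltP.
  have exp_y : exp (- y) = / INR n.+2 by rewrite exp_Ropp exp_ln.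
  have step : / INR n.+2 <= y - x.
    have : exp (x - y) = 1 - / INR n.+2.
      rewrite /Rminus exp_plus exp_y exp_ln // !S_INR; field.
      by rewrite !S_INR in N2; lra.
    by have := exp_ineq1_le (x - y); lra.
  have -> : - (sigma * y) = - (a * y) + - y by rewrite /a; ring.
  have -> : v n = exp (- (a * y)) * exp (a * (y - x)).
    by rewrite -exp_plus; congr exp; rewrite -/x; ring.
  rewrite exp_plus exp_y /v -/y.
  have ey := exp_pos (- (a * y)).
  have := exp_ineq1_le (a * (y - x)).
  have a0 : 0 < a by rewrite /a; lra.
  move=> ge_exp; apply: (Rmult_le_reg_l a) => //.
  rewrite -(Rmult_assoc a (/ a)) Rinv_r ?Rmult_1_l; last lra.
  have := Rmult_le_compat_l _ _ _ (Rlt_le _ _ ey) ge_exp.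
  have := Rmult_le_compat_l _ _ _
    (Rlt_le _ _ (Rmult_lt_0_compat _ _ a0 ey)) step.
  by lra.
apply: ex_series_scal.
exists (v 0%N - l).
suff : is_lim_seq (sum_n (fun n => v n - v n.+1)) (v 0%N - l) by [].
apply: (is_lim_seq_ext (fun n => v 0%N - v n.+1)).
  by elim=> [|n IH]; rewrite ?sum_O // sum_Sn -IH /plus /=; ring.
apply: is_lim_seq_minus' (is_lim_seq_const _) _.
exact: (proj1 (is_lim_seq_incr_1 _ _)) vl.
Qed.

Lemma series_tail_cvg0 (b : nat -> R) : ex_series b ->
  is_lim_seq (fun k => Series (fun j => b (k + j)%N)) 0.
Proof.
move=> bS; apply/is_lim_seq_incr_1.
apply: (is_lim_seq_ext (fun k => Series b - sum_n b k)).
  move=> k; rewrite (Series_incr_n b k.+1 (Nat.lt_0_succ k) bS) sum_n_Reals /=.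
  rewrite /addn /=.
  by ring.
rewrite -(Rminus_diag (Series b)).
exact: is_lim_seq_minus' (is_lim_seq_const _) (Series_correct _ bS).
Qed.

(** The factor 2 is the price of summing real and imaginary parts separately. *)
Lemma CSeries_minus_le (u v : nat -> C) (b w : nat -> R) :
  ex_series b -> ex_series w ->
  (forall n, Cmod (u n) <= b n) -> (forall n, Cmod (v n) <= b n) ->
  (forall n, Cmod (u n - v n)%C <= w n) ->
  Cmod (CSeries u - CSeries v)%C <= 2 * Series w.
Proof.
move=> bS wS ub vb uvw.
have part (f : C -> R) : (forall z, Rabs (f z) <= Cmod z) ->
    (forall x y, f (x - y)%C = f x - f y) ->
    Rabs (Series (fun n => f (u n)) - Series (fun n => f (v n))) <= Series w.
  move=> f_le fB.
  have summable (x : nat -> C) (y : nat -> R) : ex_series y ->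
      (forall n, Cmod (x n) <= y n) -> ex_series (fun n => f (x n)).
    move=> yS xy; apply: (ex_series_le (K := R_AbsRing)
      (V := R_CompleteNormedModule)) yS => n.
    exact: Rle_trans (f_le _) (xy n).
  rewrite -Series_minus; [| exact: summable bS ub | exact: summable bS vb].
  have le_w n : Rabs (f (u n) - f (v n)) <= w n.
    by rewrite -fB; apply: Rle_trans (f_le _) (uvw n).
  apply: Rle_trans (Series_Rabs _ _) _.
    apply: (ex_series_le (K := R_AbsRing) (V := R_CompleteNormedModule)) wS.
    by move=> n; rewrite /norm /= /abs /= Rabs_Rabsolu.
  by apply: Series_le wS => n; split; [apply: Rabs_pos | ].
apply: Rle_trans (Cmod_le_Re_Im _) _.
have := part Re re_le_Cmod (fun x y => erefl).
have im_le z : Rabs (Im z) <= Cmod z.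
  exact: Rle_trans (Rmax_r _ _) (Rmax_Cmod z).
have := part Im im_le (fun x y => erefl).
by rewrite /CSeries /= /Rminus; lra.
Qed.

(** * Vertical shifts of the zeta function *)

Lemma Cexp_plus x y : Cexp (x + y)%C = (Cexp x * Cexp y)%C.
Proof.
rewrite /Cexp /Cmult /Re /Im /= exp_plus cos_plus sin_plus.
by congr (_, _); ring.
Qed.

Lemma Cmod_Cexp z : Cmod (Cexp z) = exp (Re z).
Proof.
rewrite /Cmod /Cexp /=; set e := exp _.
have -> : e * cos (Im z) * (e * cos (Im z) * 1) +
          e * sin (Im z) * (e * sin (Im z) * 1) =
          e * e * (Rsqr (sin (Im z)) + Rsqr (cos (Im z))).
  by rewrite /Rsqr; ring.
by rewrite sin2_cos2 Rmult_1_r; apply/sqrt_square/Rlt_le/exp_pos.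
Qed.

Lemma Cmod_nat_Cpow n s : Cmod (nat_Cpow n s) = exp (Re s * ln (INR n)).
Proof. by rewrite Cmod_Cexp; congr exp; rewrite /Re /=; ring. Qed.

Lemma nat_Cpow_neq0 n s : nat_Cpow n s <> 0.
Proof.
by apply/Cmod_gt_0; rewrite Cmod_nat_Cpow; apply: exp_pos.
Qed.

Lemma nat_Cpow_shift n s t :
  nat_Cpow n (s + Ci * RtoC t)%C =
  (nat_Cpow n s * (cos (t * ln (INR n)), sin (t * ln (INR n))))%C.
Proof.
rewrite /nat_Cpow (_ : ((s + Ci * RtoC t) * RtoC (ln (INR n)))%C =
  (s * RtoC (ln (INR n)) + Ci * RtoC (t * ln (INR n)))%C); last first.
  by rewrite RtoC_mult; ring.
rewrite Cexp_plus; congr Cmult.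
rewrite /Cexp /= !Rmult_0_l !Rmult_1_l !Rplus_0_l Rminus_0_r exp_0.
by rewrite !Rmult_1_l.
Qed.

Lemma Cmod_dirichlet_term (n : nat) (a : R) s : a * a = 1 ->
  Cmod (RtoC a / nat_Cpow n s)%C = exp (- (Re s * ln (INR n))).
Proof.
move=> aa; rewrite Cmod_div; last exact: nat_Cpow_neq0.
rewrite Cmod_nat_Cpow Cmod_R exp_Ropp.
have -> : Rabs a = 1 by rewrite -sqrt_Rsqr_abs /Rsqr aa sqrt_1.
by rewrite /Rdiv Rmult_1_l.
Qed.

(** With E = n^(it) on the unit circle, |1 / E - a| = |1 - a E|, and its square
    is 2 - 2 a Re E since a^2 = 1. *)
Lemma Cmod_dirichlet_term_shift (n : nat) (a : R) s t : a * a = 1 ->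
  Cmod (RtoC 1 / nat_Cpow n (s + Ci * RtoC t) - RtoC a / nat_Cpow n s)%C =
  exp (- (Re s * ln (INR n))) * sqrt (2 * (1 - a * cos (t * ln (INR n)))).
Proof.
move=> aa; rewrite nat_Cpow_shift; set th := t * _.
pose E : C := (cos th, sin th).
have sc := sin2_cos2 th; rewrite /Rsqr in sc.
have E1 : Cmod E = 1.
  rewrite /Cmod /E /= -[RHS]sqrt_1; congr sqrt; lra.
have E0 : E <> 0 by apply/Cmod_gt_0; rewrite E1; lra.
have P0 : nat_Cpow n s <> 0 by apply: nat_Cpow_neq0.
have -> : (RtoC 1 / (nat_Cpow n s * E) - RtoC a / nat_Cpow n s)%C =
          (RtoC 1 / nat_Cpow n s * ((RtoC 1 - RtoC a * E) / E))%C by field.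
rewrite Cmod_mult [Cmod (_ / E)%C]Cmod_div // E1 Cmod_dirichlet_term;
  last by ring.
congr Rmult; rewrite /Rdiv Rinv_1 Rmult_1_r /Cmod /E /=; congr sqrt.
transitivity
  (1 - 2 * (a * cos th) + a * a * (sin th * sin th + cos th * cos th)).
  by ring.
by rewrite aa sc; ring.
Qed.

(** By hypothesis, the terms of the two series for an integer q <= n differ by
    at most q^(-sigma) / (n + 1); those for q > n contribute at most twice the
    tail of the majorant. *)
Lemma cvg_shift_zeta (c : nat -> R) (tau : nat -> R) :
  (forall n, c n * c n = 1) ->
  (forall n q, (0 < q <= n)%N ->
     2 * (1 - c q * cos (tau n * ln (INR q))) < / INR n.+1 ^ 2) ->
  forall A, reduced_strip A ->
    cvg_uniformly_on A (fun n s => zeta (s + Ci * RtoC (tau n))%C)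
      (dirichlet_series c).
Proof.
move=> sq close A [sigma [sigma2 [sigma1 [_ A_le]]]] eps eps0.
pose b n := exp (- (sigma * ln (INR n.+1))).
have bS : ex_series b by apply: ex_series_inv_power.
pose tail k := Series (fun j => b (k + j)%N).
pose bound n := 2 * (/ INR n.+1 * Series b + 2 * tail n).
have bound0 : is_lim_seq bound 0.
  have inv0 : is_lim_seq (fun n => / INR n.+1) 0.
    apply: (is_lim_seq_incr_1 (fun n => / INR n) 0).1.
    exact: (is_lim_seq_inv _ p_infty is_lim_seq_INR).
  have := is_lim_seq_scal_l _ 2 _ (is_lim_seq_plus' _ _ _ _
    (is_lim_seq_scal_r _ (Series b) _ inv0)
    (is_lim_seq_scal_l _ 2 _ (series_tail_cvg0 bS))).
  by rewrite /= Rmult_0_l Rmult_0_r Rplus_0_r Rmult_0_r.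
have [N NP] := proj2 (is_lim_seq_spec _ _) bound0 (mkposreal _ eps0).
exists N => n Nn s /A_le [sigma_s _].
apply: (Rle_lt_trans _ (bound n)); last first.
  have := NP n (leP Nn) => /=; rewrite Rminus_0_r.
  exact: Rle_lt_trans (Rle_abs _).
(* Series terms are indexed from 0, so the term of index k belongs to the
   integer k + 1 and is controlled by the hypothesis exactly when k < n. *)
pose b' k := if (k < n)%N then 0 else b k.
pose w k := / INR n.+1 * b k + 2 * b' k.
have b'S : ex_series b'.
  apply: (ex_series_le (K := R_AbsRing) (V := R_CompleteNormedModule)) bS => k.
  rewrite /norm /= /abs /= /b'; case: ifP => _.
    by rewrite Rabs_R0; apply/Rlt_le/exp_pos.
  by rewrite Rabs_pos_eq; [apply: Rle_refl | apply/Rlt_le/exp_pos].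
have wS : ex_series w.
  apply: (ex_series_plus (K := R_AbsRing) (V := R_NormedModule)).
  - exact: (ex_series_scal (K := R_AbsRing) (V := R_NormedModule) _ b).
  - exact: (ex_series_scal (K := R_AbsRing) (V := R_NormedModule) _ b').
have -> : bound n = 2 * Series w.
  have -> : Series w = / INR n.+1 * Series b + 2 * Series b'.
    rewrite -!Series_scal_l Series_plus //.
    - exact: (ex_series_scal (K := R_AbsRing) (V := R_NormedModule) _ b).
    - exact: (ex_series_scal (K := R_AbsRing) (V := R_NormedModule) _ b').
  rewrite (Series_incr_n_aux b' n) => [|k /ltP kn]; last by rewrite /b' kn.
  rewrite /bound /tail; congr (2 * (_ + 2 * _)); apply: Series_ext => k.
  by rewrite /b' ltnNge leq_addr.
have le_b x k : sigma <= x -> exp (- (x * ln (INR k.+1))) <= b k.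
  move=> sigma_x; rewrite /b.
  have : 0 <= ln (INR k.+1).
    rewrite -ln_1; apply: ln_le; first lra.
    by apply: (le_INR 1); apply/leP.
  move=> ln0; have : - (x * ln (INR k.+1)) <= - (sigma * ln (INR k.+1)) by nra.
  case=> [/exp_increasing/Rlt_le|->]; first by [].
  exact: Rle_refl.
apply: (CSeries_minus_le (b := b)) => // k.
- rewrite Cmod_dirichlet_term; last by ring.
  apply: le_b; move: sigma_s; rewrite /Re /=; lra.
- by rewrite Cmod_dirichlet_term //; apply: le_b.
rewrite Cmod_dirichlet_term_shift //.
set x := c _ * _.
have x_ge : -1 <= x <= 1.
  have := COS_bound (tau n * ln (INR k.+1)); rewrite /x.
  have /Rmult_integral : (c k.+1 - 1) * (c k.+1 + 1) = 0.
    by have := sq k.+1; lra.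
  by case=> ck; nra.
apply: (Rle_trans _ (b k * sqrt (2 * (1 - x)))).
  by apply: Rmult_le_compat_r; [apply: sqrt_pos | apply: le_b].
have bk0 : 0 < b k by apply: exp_pos.
have n0 : 0 < / INR n.+1 by apply/Rinv_0_lt_compat/lt_0_INR/ltP.
rewrite /w /b'; case: ltnP => kn.
  rewrite Rmult_0_r Rplus_0_r Rmult_comm; apply: Rmult_le_compat_r; first lra.
  rewrite -(sqrt_pow2 (/ INR n.+1)); last lra.
  apply: sqrt_le_1_alt; rewrite pow_inv; apply: Rlt_le.
  exact: close.
have : sqrt (2 * (1 - x)) <= 2.
  by rewrite -[X in _ <= X](sqrt_pow2 2); [apply: sqrt_le_1_alt; lra | lra].
by nra.
Qed.

(** * The sequences of shifts *)

Lemma multiplicative_sign_one : multiplicative_sign (fun=> 1).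
Proof. by split=> *; ring. Qed.

Lemma multiplicative_sign_liouville : multiplicative_sign liouville.
Proof.
split=> [n|m n m0 n0]; last by rewrite /liouville bigOmegaM // pow_add.
rewrite /liouville -Rpow_mult_distr (_ : -1 * -1 = 1) ?pow1 //.
by ring.
Qed.

Lemma exists_recurrence_time c (n : nat) (d T : R) :
  multiplicative_sign c -> 0 < d ->
  exists2 t, T < t &
    forall q, (0 < q <= n)%N -> 1 - c q * cos (t * ln (INR q)) < d.
Proof.
move=> cP d0; have n0 : 0 < INR n.+1 by apply/lt_0_INR/ltP.
have e0 : 0 < d / INR n.+1 by apply: Rdiv_lt_0_compat.
have [M [uM M0 sM folner]] := exists_folner n e0.
apply: recurrence_of_folner cP _ uM M0 sM folner.
have : INR n.+1 * (d / INR n.+1) = d by field; lra.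
by rewrite {1}S_INR; lra.
Qed.

Lemma exists_recurrence_seq c : multiplicative_sign c ->
  exists tau : nat -> R,
    [/\ forall n, 0 < tau n, strictly_increasing tau, unbounded_above tau &
      forall n q, (0 < q <= n)%N ->
        2 * (1 - c q * cos (tau n * ln (INR q))) < / INR n.+1 ^ 2].
Proof.
move=> cP.
pose close n t := forall q, (0 < q <= n)%N ->
  2 * (1 - c q * cos (t * ln (INR q))) < / INR n.+1 ^ 2.
have next n T : {t : R | T < t /\ close n t}.
  apply: constructive_indefinite_description.
  have d0 : 0 < / INR n.+1 ^ 2 / 2.
    apply/Rdiv_lt_0_compat; last lra.
    exact/Rinv_0_lt_compat/pow_lt/lt_0_INR/ltP.
  have [t Tt tP] := exists_recurrence_time n T cP d0.
  by exists t; split=> // q /tP; lra.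
(* The n-th shift also exceeds n, which makes the sequence unbounded and
   positive. *)
pose tau := fix tau n := match n with
  | 0%N => sval (next 0%N 0)
  | n'.+1 => sval (next n'.+1 (Rmax (tau n') (INR n'.+1)))
  end.
have tau_gt n : INR n < tau n.
  case: n => [|n] /=; case: (next _ _) => t [/= Tt _] //.
  exact: Rle_lt_trans (Rmax_r _ _) Tt.
exists tau; split.
- by move=> n; apply: Rle_lt_trans (pos_INR n) (tau_gt n).
- move=> n /=; case: (next _ _) => t [/= Tt _].
  exact: Rle_lt_trans (Rmax_l _ _) Tt.
- move=> A; have [n An] := INR_unbounded A.
  by exists n; apply: Rlt_trans An (tau_gt n).
by case=> [|n] /=; case: (next _ _) => t [].
Qed.

Theorem corollary7 :
  exists tau varsigma : nat -> R,
    ((forall n : nat, 0 < tau n) /\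
     strictly_increasing tau /\ unbounded_above tau) /\
    ((forall n : nat, 0 < varsigma n) /\
     strictly_increasing varsigma /\ unbounded_above varsigma) /\
    (forall S : C -> Prop, reduced_strip S ->
       cvg_uniformly_on S (fun n s => zeta (s + Ci * RtoC (tau n))%C) zeta /\
       cvg_uniformly_on S (fun n s => zeta (s + Ci * RtoC (varsigma n))%C)
         zeta_lambda).
Proof.
have [tau [tau0 tau_incr tau_unb tau_close]] :=
  exists_recurrence_seq multiplicative_sign_one.
have [vs [vs0 vs_incr vs_unb vs_close]] :=
  exists_recurrence_seq multiplicative_sign_liouville.
exists tau, vs; split; first by [].
split; first by [].
move=> A stripA; split.
- by apply: cvg_shift_zeta tau_close A stripA; case: multiplicative_sign_one.
- apply: cvg_shift_zeta vs_close A stripA.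
  by case: multiplicative_sign_liouville.
Qed.
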